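(* The group $PSL(2,\mathfrak L)$ has the finite presentation $$PSL(2,\mathfrak L)=\langle T,\tau_{\mathbf i},\tau_{\mathbf j},\tau_{\mathbf k}\mid \mathfrak R_{\mathfrak L}\rangle,$$ where $\mathfrak R_{\mathfrak L}$ consists of the relators $T^2$; $[\tau_{\mathbf i},\tau_{\mathbf j}]$, $[\tau_{\mathbf i},\tau_{\mathbf k}]$, $[\tau_{\mathbf k},\tau_{\mathbf j}]$; $(\tau_{\mathbf i}T)^6$, $(\tau_{\mathbf j}T)^6$, $(\tau_{\mathbf k}T)^6$; $(\tau_{\mathbf i}\tau_{\mathbf j}T)^4$, $(\tau_{\mathbf i}\tau_{\mathbf k}T)^4$, $(\tau_{\mathbf j}\tau_{\mathbf k}T)^4$; $(\tau_{\mathbf i}\tau_{\mathbf j}\tau_{\mathbf k}T)^6$; $(\tau_{\mathbf i}T)^3(\tau_{\mathbf j}T)^3(\tau_{\mathbf k}T)^3$, $(\tau_{\mathbf i}T)^3(\tau_{\mathbf k}T)^3(\tau_{\mathbf j}T)^3$; $[(\tau_{\mathbf u}T)^3,T]$ for $\mathbf u\in\{\mathbf i,\mathbf j,\mathbf k\}$; $[(\tau_{\mathbf u}T)^3,\tau_{\mathbf u}]$ for $\mathbf u\in\{\mathbf i,\mathbf j,\mathbf k\}$; and $(\tau_{\mathbf u}T)^3\tau_{\mathbf w}(\tau_{\mathbf u}T)^3\tau_{\mathbf w}$ for all $\mathbf u\neq\mathbf w$ in $\{\mathbf i,\mathbf j,\mathbf k\}$.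
   Context: $[x,y]=xyx^{-1}y^{-1}$ denotes the commutator. $PSL(2,\mathfrak L)$ is the group of transformations of $\mathbf H^1_{\mathbb H}=\{q\in\mathbb H:\Re q>0\}$ generated by the inversion $T(q)=q^{-1}$ and the translations $\tau_\omega(q)=q+\omega$, $\omega\in\{b\mathbf i+c\mathbf j+d\mathbf k:b,c,d\in\mathbb Z\}$; $\tau_{\mathbf i},\tau_{\mathbf j},\tau_{\mathbf k}$ are the translations by $\mathbf i,\mathbf j,\mathbf k$. (Here $(\tau_{\mathbf u}T)^3$ equals the map $q\mapsto\mathbf u q\mathbf u^{-1}$.) *)

(* Defs.v *)
From Stdlib Require Import Reals List.
Import ListNotations.
Open Scope R_scope.

Record quat := mkQ { q0 : R; q1 : R; q2 : R; q3 : R }.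

Definition qadd (p q : quat) : quat :=
  mkQ (q0 p + q0 q) (q1 p + q1 q) (q2 p + q2 q) (q3 p + q3 q).

Definition qnorm2 (q : quat) : R :=
  q0 q * q0 q + q1 q * q1 q + q2 q * q2 q + q3 q * q3 q.

(* quaternion inverse q^{-1} = conj(q)/|q|^2 (value at 0 irrelevant on H^1) *)
Definition qinv (q : quat) : quat :=
  let n := qnorm2 q in
  mkQ (q0 q / n) (- q1 q / n) (- q2 q / n) (- q3 q / n).

Definition H1 (q : quat) : Prop := 0 < q0 q.

Definition T_map (q : quat) : quat := qinv q.
Definition tau (w : quat) (q : quat) : quat := qadd q w.

Definition lat (b c d : Z) : quat := mkQ 0 (IZR b) (IZR c) (IZR d).

Definition qi : quat := lat 1 0 0.
Definition qj : quat := lat 0 1 0.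
Definition qk : quat := lat 0 0 1.
Definition qmi : quat := lat (-1) 0 0.
Definition qmj : quat := lat 0 (-1) 0.
Definition qmk : quat := lat 0 0 (-1).

(* PSL(2,L): the group of transformations of H^1 generated by T and all
   tau_w, w in L.  Since T o T = id on H^1 and tau_w^{-1} = tau_{-w}, the
   generated group equals the generated monoid. *)
Inductive in_PSL2L : (quat -> quat) -> Prop :=
| psl_id : in_PSL2L (fun q => q)
| psl_T f : in_PSL2L f -> in_PSL2L (fun q => T_map (f q))
| psl_tau (b c d : Z) f : in_PSL2L f -> in_PSL2L (fun q => tau (lat b c d) (f q)).

Inductive gen := gT | gI | gJ | gK.

(* a letter: a generator together with a flag "is inverted" *)
Definition letter : Type := (gen * bool)%type.
Definition word : Type := list letter.

Definition letter_map (l : letter) : quat -> quat :=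
  match l with
  | (gT, _) => T_map
  | (gI, false) => tau qi
  | (gI, true) => tau qmi
  | (gJ, false) => tau qj
  | (gJ, true) => tau qmj
  | (gK, false) => tau qk
  | (gK, true) => tau qmk
  end.

Definition eval (w : word) : quat -> quat :=
  fold_right (fun l f => fun q => letter_map l (f q)) (fun q => q) w.

Definition linv (l : letter) : letter := (fst l, negb (snd l)).
Definition winv (w : word) : word := rev (map linv w).

Definition g (x : gen) : word := [(x, false)].
Fixpoint wpow (w : word) (n : nat) : word :=
  match n with O => [] | S n => w ++ wpow w n end.
Definition comm (a b : word) : word := a ++ b ++ winv a ++ winv b.

Definition tT (x : gen) : word := g x ++ g gT.
Definition c3 (x : gen) : word := wpow (tT x) 3.

Definition relators : list word :=
  [ wpow (g gT) 2;
    comm (g gI) (g gJ); comm (g gI) (g gK); comm (g gK) (g gJ);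
    wpow (tT gI) 6; wpow (tT gJ) 6; wpow (tT gK) 6;
    wpow (g gI ++ g gJ ++ g gT) 4; wpow (g gI ++ g gK ++ g gT) 4;
    wpow (g gJ ++ g gK ++ g gT) 4;
    wpow (g gI ++ g gJ ++ g gK ++ g gT) 6;
    c3 gI ++ c3 gJ ++ c3 gK; c3 gI ++ c3 gK ++ c3 gJ;
    comm (c3 gI) (g gT); comm (c3 gJ) (g gT); comm (c3 gK) (g gT);
    comm (c3 gI) (g gI); comm (c3 gJ) (g gJ); comm (c3 gK) (g gK);
    c3 gI ++ g gJ ++ c3 gI ++ g gJ; c3 gI ++ g gK ++ c3 gI ++ g gK;
    c3 gJ ++ g gI ++ c3 gJ ++ g gI; c3 gJ ++ g gK ++ c3 gJ ++ g gK;
    c3 gK ++ g gI ++ c3 gK ++ g gI; c3 gK ++ g gJ ++ c3 gK ++ g gJ ].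

(* Equality in the group <T, tau_i, tau_j, tau_k | R_L>: the congruence on
   words generated by free cancellation and deletion of relators.  Thus
   pres_eq w [] iff w lies in the normal closure of R_L in the free group. *)
Inductive pres_eq : word -> word -> Prop :=
| pe_refl w : pres_eq w w
| pe_sym u v : pres_eq u v -> pres_eq v u
| pe_trans u v w : pres_eq u v -> pres_eq v w -> pres_eq u w
| pe_free u v l : pres_eq (u ++ l :: linv l :: v) (u ++ v)
| pe_rel u v r : In r relators -> pres_eq (u ++ r ++ v) (u ++ v).

(* Main.v *)
(** The group acts on hyperbolic 4-space, and the stabilizer of the cusp at
    infinity is P = <tau, c3>, an extension of the Klein four-group
    {1, c3 i, c3 j, c3 k} by Z^3, whose presentation is part of the relators.
    A coset of P is recorded by the bottom row (c, d) of a Lipschitz integral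
    matrix, with Re(conj(c) d) = 0.  Since the covering radius of Z^3 is
    sqrt 3 / 2 < 1, a Euclidean algorithm (c, d) -> (d + c m, c) with
    |d + c m| < |c| brings every row to c = 0 and so writes the coset as a word.
    This word does not depend on the choices of m, modulo the relators: the
    admissible m are the lattice points of an open unit ball, which are
    connected by unit steps inside it, and a unit step m -> m + e amounts to
    the triangle relation (tau_e T)^3 = c3 e at a smaller |c|.  Hence every
    word agrees, up to P, with the one computed from its bottom row; a word
    acting trivially has c = 0, so it lies in P, where triviality is read off.

    Conversely, each relator has matrix 1 or -1. *)
Require Import Defs.
From Stdlib Require Import Reals List.
From Stdlib Require Import ZArith Lia Lra Setoid Morphisms.
Import ListNotations.
Open Scope R_scope.

Local Infix "==" := pres_eq (at level 70).

(** * Consequences of the relators *)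

Lemma pres_eq_app_l (a u v : word) : u == v -> a ++ u == a ++ v.
Proof.
  induction 1 as [w|u v _ IH|u v w _ IH1 _ IH2|u v l|u v r Hr].
  - apply pe_refl.
  - now apply pe_sym.
  - now apply pe_trans with (a ++ v).
  - rewrite !(app_assoc a u); apply pe_free.
  - rewrite !(app_assoc a u); now apply pe_rel.
Qed.

Lemma pres_eq_app_r (a u v : word) : u == v -> u ++ a == v ++ a.
Proof.
  induction 1 as [w|u v _ IH|u v w _ IH1 _ IH2|u v l|u v r Hr].
  - apply pe_refl.
  - now apply pe_sym.
  - now apply pe_trans with (v ++ a).
  - rewrite <- !(app_assoc u); apply pe_free.
  - rewrite <- !(app_assoc u), <- (app_assoc r); now apply pe_rel.
Qed.

#[global] Instance pres_eq_Equivalence : Equivalence pres_eq.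
Proof. split; [exact pe_refl | exact pe_sym | exact pe_trans]. Qed.

#[global] Instance app_pres_eq_Proper :
  Proper (pres_eq ==> pres_eq ==> pres_eq) (@app letter).
Proof.
  intros u u' Hu v v' Hv; transitivity (u' ++ v).
  - now apply pres_eq_app_r.
  - now apply pres_eq_app_l.
Qed.

Lemma relator_trivial (r : word) : In r relators -> r == [].
Proof. intros Hr. rewrite <- (app_nil_r r). now apply (pe_rel [] []). Qed.

Lemma linvK (l : letter) : linv (linv l) = l.
Proof. destruct l as [x []]; reflexivity. Qed.

Lemma winvK (w : word) : winv (winv w) = w.
Proof.
  unfold winv; rewrite map_rev, rev_involutive, map_map.
  rewrite (map_ext _ _ linvK); apply map_id.
Qed.

Lemma app_winv (w : word) : w ++ winv w == [].
Proof.
  induction w as [|l w IH]; [reflexivity|].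
  change (winv (l :: w)) with (winv w ++ [linv l]).
  change ([l] ++ w ++ winv w ++ [linv l] == []).
  rewrite (app_assoc w), IH; apply (pe_free [] []).
Qed.

Lemma winv_app (w : word) : winv w ++ w == [].
Proof. rewrite <- (winvK w) at 2; apply app_winv. Qed.

Lemma pres_eq_cancel_l (a u v : word) : a ++ u == a ++ v -> u == v.
Proof.
  intros H; change ([] ++ u == [] ++ v).
  rewrite <- (winv_app a), <- !app_assoc; now rewrite H.
Qed.

Lemma pres_eq_cancel_r (a u v : word) : u ++ a == v ++ a -> u == v.
Proof.
  intros H; rewrite <- (app_nil_r u), <- (app_nil_r v).
  rewrite <- (app_winv a), !app_assoc; now rewrite H.
Qed.

Lemma comm_commute (a b : word) : comm a b == [] -> a ++ b == b ++ a.
Proof.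
  unfold comm; intros H.
  apply (pres_eq_cancel_r (winv a ++ winv b)).
  rewrite <- !app_assoc, H, (app_assoc a (winv a)), app_winv.
  symmetry; apply app_winv.
Qed.

Definition t : word := g gT.

Lemma t_t : t ++ t == [].
Proof. apply (relator_trivial (wpow (g gT) 2)); now left. Qed.

Ltac in_relators := simpl; tauto.

Lemma c3_c3 (x : gen) : x <> gT -> c3 x ++ c3 x == [].
Proof.
  intros Hx; apply (relator_trivial (wpow (tT x) 6)).
  destruct x; [easy| | |]; in_relators.
Qed.

Lemma c3_t (x : gen) : x <> gT -> c3 x ++ t == t ++ c3 x.
Proof.
  intros Hx; apply comm_commute, relator_trivial.
  destruct x; [easy| | |]; in_relators.
Qed.

Lemma g_commute (x y : gen) : x <> gT -> y <> gT -> g x ++ g y == g y ++ g x.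
Proof.
  intros Hx Hy; destruct x, y; try easy;
    (apply comm_commute, relator_trivial; in_relators) ||
    (symmetry; apply comm_commute, relator_trivial; in_relators).
Qed.

Lemma c3_g_same (x : gen) : x <> gT -> c3 x ++ g x == g x ++ c3 x.
Proof.
  intros Hx; apply comm_commute, relator_trivial.
  destruct x; [easy| | |]; in_relators.
Qed.

(** By the relators both [c3 x] and [c3 x ++ g y] are involutions. Geometrically, conjugation by one
    imaginary unit negates the other two. *)
Lemma c3_g_other (x y : gen) :
  x <> gT -> y <> gT -> x <> y -> c3 x ++ g y == winv (g y) ++ c3 x.
Proof.
  intros Hx Hy Hxy; apply (pres_eq_cancel_r (c3 x ++ g y)), (pres_eq_cancel_l (g y)).
  transitivity (g y).
  - transitivity (g y ++ []); [|now rewrite app_nil_r].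
    apply pres_eq_app_l; rewrite <- app_assoc; apply relator_trivial.
    destruct x, y; try easy; in_relators.
  - rewrite <- !app_assoc, (app_assoc (c3 x)), (c3_c3 x Hx).
    rewrite (app_assoc (g y)), app_winv; reflexivity.
Qed.

Definition zpow (x : gen) (n : Z) : word := repeat (x, Z.ltb n 0) (Z.abs_nat n).

Lemma zpow_succ (x : gen) (n : Z) : zpow x (Z.succ n) == g x ++ zpow x n.
Proof.
  unfold zpow; destruct (Z.ltb_spec n 0) as [Hn|Hn].
  - replace (Z.abs_nat n) with (S (Z.abs_nat (Z.succ n))) by lia.
    symmetry; etransitivity; [apply (pe_free [] _ (x, false))|].
    (* When the sign changes, n is -1: the flag flips, but the remaining word is empty. *)
    destruct (Z.ltb_spec (Z.succ n) 0) as [|Hn']; [reflexivity|].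
    replace (Z.abs_nat (Z.succ n)) with O by lia; reflexivity.
  - destruct (Z.ltb_spec (Z.succ n) 0); [lia|].
    replace (Z.abs_nat (Z.succ n)) with (S (Z.abs_nat n)) by lia; reflexivity.
Qed.

Lemma zpow_add (x : gen) (m n : Z) : zpow x (m + n) == zpow x m ++ zpow x n.
Proof.
  induction m as [|m IH|m IH] using Z.peano_ind.
  - reflexivity.
  - rewrite Z.add_succ_l, !zpow_succ, IH; now rewrite app_assoc.
  - apply (pres_eq_cancel_l (g x)).
    rewrite app_assoc, <- !zpow_succ, <- Z.add_succ_l, Z.succ_pred; exact IH.
Qed.

(** Two-sided induction on the exponent. It is applied with s = 1 for commutation and s = -1 for
    inversion. *)
Lemma slide_zpow (a : word) (x : gen) (s : Z) :
  a ++ g x == zpow x s ++ a -> forall n, a ++ zpow x n == zpow x (s * n) ++ a.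
Proof.
  intros H n; induction n as [|n IH|n IH] using Z.peano_ind.
  - rewrite Z.mul_0_r, app_nil_r; reflexivity.
  - rewrite zpow_succ, app_assoc, H, <- app_assoc, IH, app_assoc, <- zpow_add.
    now replace (s + s * n)%Z with (s * Z.succ n)%Z by lia.
  - apply (pres_eq_cancel_l (zpow x s)).
    rewrite app_assoc, <- H, <- app_assoc, <- zpow_succ, Z.succ_pred, IH.
    rewrite app_assoc, <- zpow_add.
    now replace (s + s * Z.pred n)%Z with (s * n)%Z by lia.
Qed.

Lemma zpow_commute (x y : gen) (m n : Z) :
  x <> gT -> y <> gT -> zpow x m ++ zpow y n == zpow y n ++ zpow x m.
Proof.
  intros Hx Hy; rewrite (slide_zpow (zpow x m) y 1), Z.mul_1_l; [reflexivity|].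
  change (zpow y 1) with (g y).
  symmetry; rewrite (slide_zpow (g y) x 1), Z.mul_1_l; [reflexivity|].
  now apply g_commute.
Qed.

Lemma c3_zpow_same (x : gen) (n : Z) : x <> gT -> c3 x ++ zpow x n == zpow x n ++ c3 x.
Proof.
  intros Hx; rewrite (slide_zpow (c3 x) x 1), Z.mul_1_l; [reflexivity|].
  now apply c3_g_same.
Qed.

Lemma c3_zpow_other (x y : gen) (n : Z) :
  x <> gT -> y <> gT -> x <> y -> c3 x ++ zpow y n == zpow y (- n) ++ c3 x.
Proof.
  intros Hx Hy Hxy; rewrite (slide_zpow (c3 x) y (-1)).
  - now replace (-1 * n)%Z with (- n)%Z by ring.
  - now apply c3_g_other.
Qed.

(** * Lipschitz quaternions and the stabilizer of infinity *)

Record zquat := mkZ { z0 : Z; z1 : Z; z2 : Z; z3 : Z }.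

Definition zadd (p q : zquat) : zquat :=
  mkZ (z0 p + z0 q) (z1 p + z1 q) (z2 p + z2 q) (z3 p + z3 q).

Definition zopp (p : zquat) : zquat := mkZ (- z0 p) (- z1 p) (- z2 p) (- z3 p).

Definition zmul (p q : zquat) : zquat :=
  mkZ (z0 p * z0 q - z1 p * z1 q - z2 p * z2 q - z3 p * z3 q)
      (z0 p * z1 q + z1 p * z0 q + z2 p * z3 q - z3 p * z2 q)
      (z0 p * z2 q - z1 p * z3 q + z2 p * z0 q + z3 p * z1 q)
      (z0 p * z3 q + z1 p * z2 q - z2 p * z1 q + z3 p * z0 q).

Definition zinner (p q : zquat) : Z :=
  z0 p * z0 q + z1 p * z1 q + z2 p * z2 q + z3 p * z3 q.

Definition znorm (p : zquat) : Z := zinner p p.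

Definition zzero : zquat := mkZ 0 0 0 0.
Definition zone : zquat := mkZ 1 0 0 0.

Definition letter_zquat (l : letter) : zquat :=
  let s := if snd l then (-1)%Z else 1%Z in
  match fst l with
  | gT => zzero
  | gI => mkZ 0 s 0 0
  | gJ => mkZ 0 0 s 0
  | gK => mkZ 0 0 0 s
  end.

(* The real part of [m] is ignored. *)
Definition tw (m : zquat) : word := zpow gI (z1 m) ++ zpow gJ (z2 m) ++ zpow gK (z3 m).

Lemma tw_letter (l : letter) : fst l <> gT -> tw (letter_zquat l) = [l].
Proof. destruct l as [[] []]; intros Hl; easy. Qed.

Lemma tw_add (m n : zquat) : tw (zadd m n) == tw m ++ tw n.
Proof.
  unfold tw; simpl; rewrite !zpow_add, <- !app_assoc.
  apply pres_eq_app_l.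
  rewrite (app_assoc (zpow gK (z3 m))), (zpow_commute gK gI), <- !app_assoc by easy.
  rewrite (app_assoc (zpow gJ (z2 m)) (zpow gI (z1 n))), (zpow_commute gJ gI),
    <- !app_assoc by easy.
  do 2 apply pres_eq_app_l.
  now rewrite (app_assoc (zpow gK (z3 m))), (zpow_commute gK gJ), <- !app_assoc by easy.
Qed.

(** For an imaginary unit e, [zopp] gives the inverse, so the left-hand translation is by the
    conjugate of m by e. It keeps the coordinate along e and negates the other two, for either sign
    of e. *)
Lemma c3_tw (l : letter) (m : zquat) :
  fst l <> gT ->
  c3 (fst l) ++ tw (zmul (zopp (letter_zquat l)) (zmul m (letter_zquat l)))
  == tw m ++ c3 (fst l).
Proof.
  intros Hl.
  assert (H : forall b c d : Z, c3 (fst l) ++ zpow gI b ++ zpow gJ c ++ zpow gK d ==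
    zpow gI (match fst l with gI => b | _ => - b end) ++
    zpow gJ (match fst l with gJ => c | _ => - c end) ++
    zpow gK (match fst l with gK => d | _ => - d end) ++ c3 (fst l)).
  { intros b c d; destruct l as [[] s]; [easy| | |]; cbn [fst].
    - rewrite app_assoc, c3_zpow_same, <- app_assoc, (app_assoc (c3 gI)),
        (c3_zpow_other gI gJ), <- app_assoc, (c3_zpow_other gI gK) by easy; reflexivity.
    - rewrite app_assoc, (c3_zpow_other gJ gI), <- app_assoc, (app_assoc (c3 gJ)),
        c3_zpow_same, <- app_assoc, (c3_zpow_other gJ gK) by easy; reflexivity.
    - rewrite app_assoc, (c3_zpow_other gK gI), <- app_assoc, (app_assoc (c3 gK)),
        (c3_zpow_other gK gJ), <- app_assoc, c3_zpow_same by easy; reflexivity. }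
  unfold tw at 1; rewrite H; clear H; unfold tw; rewrite <- !app_assoc.
  destruct m as [m0 m1 m2 m3]; destruct l as [[] []]; try easy; cbn [fst snd letter_zquat zmul zopp z0 z1 z2 z3 zinner];
  match goal with |- zpow _ ?a ++ zpow _ ?b ++ zpow _ ?c ++ _ == zpow _ ?a' ++ zpow _ ?b' ++ zpow _ ?c' ++ _ =>
    replace a with a' by ring; replace b with b' by ring; replace c with c' by ring end; reflexivity.
Qed.

(** The inverse of the cube of x^{-1} T is the cube of T x, a conjugate of [c3 x] by T. As [c3 x] is
    an involution commuting with T, inverted letters give the same cube. *)
Lemma cube_letter (l : letter) :
  fst l <> gT -> [l] ++ t ++ [l] ++ t ++ [l] ++ t == c3 (fst l).
Proof.
  destruct l as [x []]; simpl; intros Hx; [|reflexivity].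
  apply (pres_eq_cancel_l (c3 x)); rewrite (c3_c3 x Hx).
  (* Conjugating by [t] brings the two cubes face to face; they then collapse from the middle
     outwards. *)
  apply (pres_eq_cancel_l t), (pres_eq_cancel_r t).
  change ((t ++ c3 x ++ [(x, true); (gT, false); (x, true); (gT, false); (x, true)] ++ t) ++ t == t ++ t).
  rewrite <- !app_assoc, !t_t, app_nil_r, app_assoc, <- (c3_t x Hx).
  change ([(x, false); (gT, false); (x, false); (gT, false); (x, false)] ++ (t ++ t)
    ++ [(x, true); (gT, false); (x, true); (gT, false); (x, true)] == []).
  rewrite t_t.
  change ([(x, false); (gT, false); (x, false); (gT, false)] ++ (x, false) :: linv (x, false) ::
    [(gT, false); (x, true); (gT, false); (x, true)] == []).
  rewrite pe_free.
  change ([(x, false); (gT, false); (x, false)] ++ (t ++ t)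
    ++ [(x, true); (gT, false); (x, true)] == []).
  rewrite t_t.
  change ([(x, false); (gT, false)] ++ (x, false) :: linv (x, false) :: [(gT, false); (x, true)] == []).
  rewrite pe_free.
  change (g x ++ (t ++ t) ++ winv (g x) == []).
  rewrite t_t; apply app_winv.
Qed.

(** [gT] serves as the index of the identity, so that [gen] indexes the whole Klein four-group. *)
Definition klein (x : gen) : word := match x with gT => [] | _ => c3 x end.

Lemma klein_klein (x : gen) : klein x ++ klein x == [].
Proof. destruct x; [reflexivity|now apply c3_c3..]. Qed.

Lemma klein_solve (x y z : gen) :
  klein x ++ klein y == klein z -> klein x ++ klein z == klein y.
Proof. intros <-; rewrite app_assoc, klein_klein; reflexivity. Qed.

(** The two relators of length three in the [c3] give ij, ik, jk and kj; the products ji and ki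
    follow because every element is an involution. *)
Lemma klein_mul (x y : gen) : exists z, klein x ++ klein y == klein z.
Proof.
  assert (H : forall a b c : gen,
    In (klein a ++ klein b ++ klein c) relators -> klein a ++ klein b == klein c).
  { intros a b c Hin; apply (pres_eq_cancel_r (klein c)).
    rewrite klein_klein, <- app_assoc; now apply relator_trivial. }
  assert (Hij : klein gI ++ klein gJ == klein gK) by (apply H; in_relators).
  assert (Hik : klein gI ++ klein gK == klein gJ) by (apply H; in_relators).
  assert (Hjk : klein gJ ++ klein gK == klein gI).
  { apply (pres_eq_cancel_l (klein gI)); rewrite klein_klein; apply relator_trivial; in_relators. }
  assert (Hkj : klein gK ++ klein gJ == klein gI).
  { apply (pres_eq_cancel_l (klein gI)); rewrite klein_klein; apply relator_trivial; in_relators. }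
  destruct x; [now exists y| | |];
    (destruct y; [eexists; rewrite app_nil_r; reflexivity| | |]);
    try (exists gT; apply klein_klein); eauto using klein_solve.
Qed.

Ltac zq_unfold :=
  repeat match goal with |- context [?q] =>
    is_var q; lazymatch type of q with zquat => destruct q end end;
  cbv beta iota zeta delta [fst snd letter_zquat znorm zadd zopp zmul zinner zzero zone
    z0 z1 z2 z3] in *;
  subst.
Ltac zq_ring := match goal with |- mkZ _ _ _ _ = _ => f_equal; ring | |- _ => ring end.
Ltac zq := intros; zq_unfold; zq_ring.
Ltac zql l := intros; destruct l as [[] []]; try easy; zq_unfold; zq_ring.

Lemma klein_tw (x : gen) (m : zquat) :
  exists m', klein x ++ tw m == tw m' ++ klein x.
Proof.
  assert (H : forall l : letter, fst l <> gT ->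
    exists m', c3 (fst l) ++ tw m == tw m' ++ c3 (fst l)).
  { intros l Hl; set (e := letter_zquat l).
    exists (zmul e (zmul m (zopp e))).
    rewrite <- (c3_tw l _ Hl); subst e.
    now replace (zmul _ (zmul _ (letter_zquat l))) with m by (clear - Hl; zql l). }
  destruct x.
  - exists m; now rewrite app_nil_r.
  - now apply (H (gI, false)).
  - now apply (H (gJ, false)).
  - now apply (H (gK, false)).
Qed.

(* The stabilizer of the cusp at infinity. *)
Definition cuspidal (w : word) : Prop := exists m x, w == tw m ++ klein x.

Lemma cuspidal_app (u v : word) : cuspidal u -> cuspidal v -> cuspidal (u ++ v).
Proof.
  intros (m & x & Hu) (n & y & Hv).
  destruct (klein_tw x n) as [n' Hn'], (klein_mul x y) as [z Hz].
  exists (zadd m n'), z.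
  rewrite Hu, Hv, <- app_assoc, (app_assoc (klein x)), Hn', tw_add, <- Hz.
  now rewrite !app_assoc.
Qed.

Lemma cuspidal_tw (m : zquat) : cuspidal (tw m).
Proof. exists m, gT; simpl; now rewrite app_nil_r. Qed.

Lemma cuspidal_nil : cuspidal [].
Proof. apply (cuspidal_tw zzero). Qed.

Lemma cuspidal_klein (x : gen) : cuspidal (klein x).
Proof. now exists zzero, x. Qed.

Lemma cuspidal_pres_eq (u v : word) : u == v -> cuspidal v -> cuspidal u.
Proof. intros H (m & x & Hv); exists m, x; now rewrite H. Qed.

Lemma tw_opp (m : zquat) : tw (zopp m) ++ tw m == [].
Proof. rewrite <- tw_add; replace (zadd (zopp m) m) with zzero by zq; reflexivity. Qed.

Lemma cuspidal_inv (p : word) : cuspidal p -> exists p', cuspidal p' /\ p' ++ p == [].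
Proof.
  intros (m & x & H); exists (klein x ++ tw (zopp m)); split.
  - apply cuspidal_app; [apply cuspidal_klein|apply cuspidal_tw].
  - rewrite H, <- app_assoc, (app_assoc (tw _)), tw_opp; apply klein_klein.
Qed.

Definition same_coset (u v : word) : Prop := exists p, cuspidal p /\ u == p ++ v.

#[global] Instance same_coset_Equivalence : Equivalence same_coset.
Proof.
  split.
  - intros u; exists []; split; [apply cuspidal_nil|reflexivity].
  - intros u v (p & Hp & H); destruct (cuspidal_inv p Hp) as (p' & Hp' & Hpp).
    exists p'; split; [assumption|]; now rewrite H, app_assoc, Hpp.
  - intros u v w (p & Hp & Hu) (p' & Hp' & Hv); exists (p ++ p'); split.
    + now apply cuspidal_app.
    + now rewrite Hu, Hv, app_assoc.
Qed.

#[global] Instance same_coset_Proper :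
  Proper (pres_eq ==> pres_eq ==> iff) same_coset.
Proof.
  intros u u' Hu v v' Hv; split; intros (p & Hp & H); exists p; split; trivial.
  - now rewrite <- Hu, <- Hv.
  - now rewrite Hu, Hv.
Qed.

(** Cuspidal factors are absorbed on the left only, so the right factor may vary only up to
    [pres_eq]. *)
#[global] Instance app_same_coset_Proper :
  Proper (same_coset ==> pres_eq ==> same_coset) (@app letter).
Proof.
  intros u u' (p & Hp & H) v v' Hv; exists p; split; [assumption|].
  now rewrite H, Hv, app_assoc.
Qed.

(** * The Euclidean algorithm on bottom rows *)

(* [(c, d)] is the bottom row of the matrix of [w]; it determines [w] only up to
   left multiplication by the stabilizer of infinity. *)
Inductive represents : zquat -> zquat -> word -> Prop :=
| rep_cusp d w : cuspidal w -> represents zzero d w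
| rep_step c d m u w :
    z0 m = 0%Z -> (znorm (zadd d (zmul c m)) < znorm c)%Z ->
    represents (zadd d (zmul c m)) c u -> w == u ++ t ++ tw (zopp m) ->
    represents c d w.

Lemma represents_same_coset (c d : zquat) (u v : word) :
  represents c d u -> same_coset v u -> represents c d v.
Proof.
  intros H; revert v; induction H as [d w Hw|c d m u w Hm Hlt _ IH Hw];
    intros v (p & Hp & Hv).
  - apply rep_cusp, (cuspidal_pres_eq _ _ Hv), cuspidal_app; assumption.
  - apply (rep_step c d m (p ++ u)); trivial.
    + apply IH; now exists p.
    + now rewrite Hv, Hw, !app_assoc.
Qed.

Lemma represents_pres_eq (c d : zquat) (u v : word) :
  represents c d u -> u == v -> represents c d v.
Proof. intros H E; apply (represents_same_coset c d u); trivial. rewrite E; reflexivity. Qed.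

(** Replacing the first translation n by n - m leads to the same reduced row, so only the first step
    of the algorithm changes. *)
Lemma represents_tw (c d m : zquat) (w : word) :
  z0 m = 0%Z -> represents c d w -> represents c (zadd d (zmul c m)) (w ++ tw m).
Proof.
  intros Hm H; destruct H as [d w Hw|c d n u w Hn Hlt Hu Hw].
  - apply rep_cusp, cuspidal_app; [assumption|apply cuspidal_tw].
  - assert (E : zadd (zadd d (zmul c m)) (zmul c (zadd n (zopp m))) = zadd d (zmul c n))
      by zq.
    apply (rep_step _ _ (zadd n (zopp m)) u); rewrite ?E; trivial.
    + simpl; lia.
    + rewrite Hw, <- !app_assoc, <- tw_add.
      now replace (zadd (zopp n) m) with (zopp (zadd n (zopp m))) by zq.
Qed.

(** A transformation determines its matrix only up to sign; the same translations reduce both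
    rows. *)
Lemma represents_opp (c d : zquat) (w : word) :
  represents c d w -> represents (zopp c) (zopp d) w.
Proof.
  induction 1 as [d w Hw|c d m u w Hm Hlt _ IH Hw].
  - now apply rep_cusp.
  - assert (E : zadd (zopp d) (zmul (zopp c) m) = zopp (zadd d (zmul c m))) by zq.
    assert (N : forall p, znorm (zopp p) = znorm p) by zq.
    apply (rep_step _ _ m u); rewrite ?E, ?N; trivial.
Qed.

(** The matrix of [c3] is diag(e, e). With n = e^{-1} m e one has d e + (c e) n = (d + c m) e, and
    the unit e preserves norms, so every step of the algorithm carries over. *)
Lemma represents_klein (l : letter) (c d : zquat) (w : word) :
  fst l <> gT -> represents c d w ->
  represents (zmul c (letter_zquat l)) (zmul d (letter_zquat l)) (w ++ c3 (fst l)).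
Proof.
  intros Hl; induction 1 as [d w Hw|c d m u w Hm Hlt _ IH Hw].
  - replace (zmul zzero (letter_zquat l)) with zzero by zq.
    apply rep_cusp, cuspidal_app; [assumption|].
    replace (c3 (fst l)) with (klein (fst l)); [apply cuspidal_klein|].
    now destruct l as [[] ?].
  - set (e := letter_zquat l) in *.
    set (n := zmul (zopp e) (zmul m e)).
    assert (E : zadd (zmul d e) (zmul (zmul c e) n) = zmul (zadd d (zmul c m)) e).
    { subst n e; clear - Hl Hm. zql l. }
    assert (N : forall p, znorm (zmul p e) = znorm p).
    { subst e; clear - Hl; zql l. }
    apply (rep_step _ _ n (u ++ c3 (fst l))); rewrite ?E, ?N; trivial.
    + subst n e; clear - Hl Hm; zql l.
    + rewrite Hw, <- !app_assoc, <- (c3_tw l) by assumption.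
      rewrite (app_assoc t), <- (c3_t (fst l)), <- app_assoc by assumption.
      now replace (zopp n) with (zmul (zopp e) (zmul (zopp m) e))
        by (subst n; clearbody e; clear; zq).
Qed.

(** * Norms and reduction modulo the cubic lattice *)

Lemma znorm_ge0 (p : zquat) : (0 <= znorm p)%Z.
Proof. unfold znorm, zinner; nia. Qed.

Lemma znorm_eq0 (p : zquat) : znorm p = 0%Z -> p = zzero.
Proof.
  destruct p as [a b c d]; unfold znorm, zinner, zzero; cbn [z0 z1 z2 z3]; intros H.
  f_equal; nia.
Qed.

Lemma znorm_gt0 (p : zquat) : p <> zzero -> (0 < znorm p)%Z.
Proof.
  intros Hp; pose proof (znorm_ge0 p).
  destruct (Z.eq_dec (znorm p) 0) as [E|]; [|lia].
  now apply znorm_eq0 in E.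
Qed.

Lemma znorm_opp (p : zquat) : znorm (zopp p) = znorm p.
Proof. zq. Qed.

Lemma znorm_unit (l : letter) (p : zquat) :
  fst l <> gT -> znorm (zmul p (letter_zquat l)) = znorm p.
Proof. zql l. Qed.

Definition zconj (p : zquat) : zquat := mkZ (z0 p) (- z1 p) (- z2 p) (- z3 p).

(* Multiplying by [conj c] moves the problem to the cubic lattice scaled by
   [znorm c], in the purely imaginary quaternions. *)
Lemma znorm_translate (c d m : zquat) :
  z0 m = 0%Z -> zinner c d = 0%Z ->
  let s := zmul (zconj c) d in
  (znorm c * znorm (zadd d (zmul c m)) =
   (z1 s + znorm c * z1 m) * (z1 s + znorm c * z1 m) +
   (z2 s + znorm c * z2 m) * (z2 s + znorm c * z2 m) +
   (z3 s + znorm c * z3 m) * (z3 s + znorm c * z3 m))%Z.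
Proof.
  intros Hm Hcd s.
  (* The real part of conj(c) d is [zinner c d]; its square completes the multiplicativity of the
     norm and vanishes by orthogonality. *)
  transitivity (zinner c d * zinner c d +
    ((z1 s + znorm c * z1 m) * (z1 s + znorm c * z1 m) +
     (z2 s + znorm c * z2 m) * (z2 s + znorm c * z2 m) +
     (z3 s + znorm c * z3 m) * (z3 s + znorm c * z3 m)))%Z; [|now rewrite Hcd].
  clear Hcd; subst s; unfold zconj; zq.
Qed.

Lemma zinner_sym (c d : zquat) : zinner c d = zinner d c.
Proof. zq. Qed.

(** Since conj(c) c m is |c|^2 m, an imaginary m adds nothing to the real part. *)
Lemma zinner_translate (c d m : zquat) :
  z0 m = 0%Z -> zinner c d = 0%Z -> zinner c (zadd d (zmul c m)) = 0%Z.
Proof. intros Hm Hcd; rewrite <- Hcd; clear Hcd; zq. Qed.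

Lemma centered_remainder (n s : Z) : (0 < n)%Z -> exists k, (- n <= 2 * (s + n * k) <= n)%Z.
Proof.
  (* Minus the integer nearest to s / n, that is, minus the floor of s / n + 1/2. *)
  intros Hn; exists (- ((2 * s + n) / (2 * n)))%Z.
  pose proof (Z.div_mod (2 * s + n) (2 * n)); pose proof (Z.mod_pos_bound (2 * s + n) (2 * n)).
  nia.
Qed.

(* The covering radius of Z^3 is sqrt 3 / 2 < 1. *)
Lemma exists_reduction (c d : zquat) :
  c <> zzero -> zinner c d = 0%Z ->
  exists m, z0 m = 0%Z /\ (znorm (zadd d (zmul c m)) < znorm c)%Z.
Proof.
  intros Hc Hcd; apply znorm_gt0 in Hc.
  set (s := zmul (zconj c) d).
  destruct (centered_remainder (znorm c) (z1 s) Hc) as [k1 H1].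
  destruct (centered_remainder (znorm c) (z2 s) Hc) as [k2 H2].
  destruct (centered_remainder (znorm c) (z3 s) Hc) as [k3 H3].
  exists (mkZ 0 k1 k2 k3); split; [reflexivity|].
  pose proof (znorm_translate c d (mkZ 0 k1 k2 k3) eq_refl Hcd) as E.
  fold s in E; cbn [z1 z2 z3] in E; cbv zeta in E.
  set (n := znorm c) in *; set (N := znorm _) in *; clearbody n N.
  set (x := (z1 s + n * k1)%Z) in *; set (y := (z2 s + n * k2)%Z) in *;
    set (z := (z3 s + n * k3)%Z) in *; clearbody x y z.
  (* The three squares add up to at most 3 n^2 / 4, and their sum is n N, whence N < n. *)
  assert (4 * (x * x) <= n * n)%Z by nia.
  assert (4 * (y * y) <= n * n)%Z by nia.
  assert (4 * (z * z) <= n * n)%Z by nia.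
  nia.
Qed.

Lemma represents_exists (c d : zquat) : zinner c d = 0%Z -> exists w, represents c d w.
Proof.
  remember (znorm c) as n eqn:Hn; revert c d Hn.
  induction n as [n IH] using (well_founded_induction (Z.lt_wf 0)); intros c d -> Hcd.
  destruct (Z.eq_dec (znorm c) 0) as [H0|H0].
  - apply znorm_eq0 in H0 as ->; exists []; apply rep_cusp, cuspidal_nil.
  - assert (Hc : c <> zzero) by (intros ->; now apply H0).
    destruct (exists_reduction c d Hc Hcd) as (m & Hm & Hlt).
    destruct (IH (znorm (zadd d (zmul c m)))) with (c := zadd d (zmul c m)) (d := c)
      as [u Hu]; trivial.
    + split; [apply znorm_ge0|assumption].
    + rewrite zinner_sym; now apply zinner_translate.
    + exists (u ++ t ++ tw (zopp m)); now apply (rep_step c d m u).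
Qed.

(* [|d/c| = 1]: some coordinate of the point has absolute value at least
   [1 / sqrt 3 > 1 / 2]. *)
Lemma exists_unit_reduction (c d : zquat) :
  c <> zzero -> zinner c d = 0%Z -> znorm d = znorm c ->
  exists l, fst l <> gT /\ (znorm (zadd d (zmul c (letter_zquat l))) < znorm c)%Z.
Proof.
  intros Hc Hcd Hdc; apply znorm_gt0 in Hc.
  assert (H : forall l, fst l <> gT ->
    (znorm (zadd d (zmul c (letter_zquat l))) < znorm c)%Z \/
    (znorm c <= znorm (zadd d (zmul c (letter_zquat l))))%Z) by (intros; lia).
  assert (E : forall l, fst l <> gT -> _) by
    (intros l Hl; refine (znorm_translate c d (letter_zquat l) _ Hcd);
     now destruct l as [[] []]).
  pose proof (znorm_translate c d zzero eq_refl Hcd) as E0.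
  replace (zadd d (zmul c zzero)) with d in E0 by zq.
  rewrite Hdc in E0; cbv zeta in E, E0.
  set (n := znorm c) in *; set (s := zmul (zconj c) d) in *.
  destruct (H (gI, false)) as [|F1]; [easy|now exists (gI, false)|].
  destruct (H (gI, true)) as [|F2]; [easy|now exists (gI, true)|].
  destruct (H (gJ, false)) as [|F3]; [easy|now exists (gJ, false)|].
  destruct (H (gJ, true)) as [|F4]; [easy|now exists (gJ, true)|].
  destruct (H (gK, false)) as [|F5]; [easy|now exists (gK, false)|].
  destruct (H (gK, true)) as [|F6]; [easy|now exists (gK, true)|].
  exfalso.
  (* Expanding |s + n e|^2 with |s| = n: a unit step e that does not reduce the row bounds the
     coordinate of s along e from below by -n / 2. *)
  assert (G : forall l, fst l <> gT ->
    (n <= znorm (zadd d (zmul c (letter_zquat l))))%Z ->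
    (0 <= 2 * (z1 s * z1 (letter_zquat l) + z2 s * z2 (letter_zquat l) +
       z3 s * z3 (letter_zquat l)) + n)%Z).
  { intros l Hl F; specialize (E l Hl).
    assert (Hu : (z1 (letter_zquat l) * z1 (letter_zquat l) +
      z2 (letter_zquat l) * z2 (letter_zquat l) +
      z3 (letter_zquat l) * z3 (letter_zquat l) = 1)%Z) by (now destruct l as [[] []]).
    set (N := znorm (zadd d _)) in *; clearbody N.
    cbn [z1 z2 z3 zzero] in E0.
    destruct (letter_zquat l) as [w x y z]; cbn [z1 z2 z3] in *.
    assert (n * (N - n) = n * (2 * (z1 s * x + z2 s * y + z3 s * z) + n))%Z.
    { transitivity (n * N - n * n)%Z; [ring|]; rewrite E, E0.
      transitivity (2 * n * (z1 s * x + z2 s * y + z3 s * z) + n * n * (x * x + y * y + z * z))%Z;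
        [ring|rewrite Hu; ring]. }
    apply (Z.mul_cancel_l) in H0; lia. }
  clear E H.
  apply G in F1, F2, F3, F4, F5, F6; try easy.
  cbn [z1 z2 z3 letter_zquat fst snd zzero] in *.
  clearbody n; set (x := z1 s) in *; set (y := z2 s) in *; set (z := z3 s) in *;
    clearbody x y z.
  (* The two signs on each axis bound every coordinate by n / 2 in absolute value, so |s|^2 is at
     most 3 n^2 / 4, against |s|^2 = n^2. *)
  assert (4 * (x * x) <= n * n)%Z by nia.
  assert (4 * (y * y) <= n * n)%Z by nia.
  assert (4 * (z * z) <= n * n)%Z by nia.
  nia.
Qed.

(** * The triangle relation and the interchange of the two entries of a row *)

Lemma c3_letter (l : letter) : fst l <> gT -> c3 (fst l) ++ [l] == [l] ++ c3 (fst l).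
Proof.
  intros Hl; rewrite <- (tw_letter l Hl) at 2.
  rewrite <- (c3_tw l _ Hl).
  replace (zmul _ (zmul _ _)) with (letter_zquat l) by (zql l).
  now rewrite (tw_letter l Hl).
Qed.

Lemma letter_linv (l : letter) : [l] ++ [linv l] == [].
Proof. apply (pe_free [] []). Qed.

(** This is [cube_letter] solved for the factor [t ++ [l] ++ t]. *)
Lemma t_letter_t (l : letter) :
  fst l <> gT -> t ++ [l] ++ t == [linv l] ++ c3 (fst l) ++ t ++ [linv l].
Proof.
  intros Hl; apply (pres_eq_cancel_l [l]), (pres_eq_cancel_r ([l] ++ t)).
  rewrite <- !app_assoc, (cube_letter l Hl).
  rewrite (app_assoc [l] [linv l]), letter_linv.
  pose proof (letter_linv (linv l)) as H; rewrite linvK in H.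
  now rewrite (app_assoc [linv l] [l]), H, t_t, app_nil_r.
Qed.

(** Once [t] is appended, [c3] commutes to the front and the rest is the cube, again [c3]; the two
    cancel. In this form the relation closes the circuit in [compatible_letter]. *)
Lemma t_letter_c3_letter_t (l : letter) :
  fst l <> gT -> [l] ++ t ++ c3 (fst l) ++ [l] ++ t ++ [l] == t.
Proof.
  intros Hl; apply (pres_eq_cancel_r t).
  rewrite <- !app_assoc.
  rewrite (app_assoc t (c3 _)), <- (c3_t _ Hl), <- app_assoc, (app_assoc [l] (c3 _)),
    <- (c3_letter l Hl), <- app_assoc, (cube_letter l Hl), (c3_c3 _ Hl), t_t.
  reflexivity.
Qed.

Definition unique_at (c d : zquat) : Prop :=
  forall u v, represents c d u -> represents c d v -> same_coset u v.

(** The zero translation is already a reducing step for (d, c), and it leads to (c, d). *)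
Lemma represents_t_lt (c d : zquat) (w : word) :
  (znorm c < znorm d)%Z -> represents c d w -> represents d c (w ++ t).
Proof.
  assert (E : zadd c (zmul d zzero) = c) by zq.
  intros Hlt H; apply (rep_step d c zzero w); rewrite ?E; trivial.
  now rewrite app_nil_r.
Qed.

Lemma letter_zquat_linv (l : letter) : letter_zquat (linv l) = zopp (letter_zquat l).
Proof. now destruct l as [[] []]. Qed.

Lemma z0_letter_zquat (l : letter) : z0 (letter_zquat l) = 0%Z.
Proof. now destruct l as [[] []]. Qed.

(** If |c| < |d|, the swap is a step of the algorithm; if |d| < |c|, it is the inverse of one, and
    uniqueness at (c, d) identifies the cosets. If |c| = |d|, a unit translation e reduces both (c,
    d) and (d, c), and the triangle relation compares the results. *)
Lemma represents_t (c d : zquat) (w : word) :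
  zinner c d = 0%Z -> ~ (c = zzero /\ d = zzero) -> unique_at c d ->
  represents c d w -> represents d c (w ++ t).
Proof.
  intros Hcd Hnz Huniq Hw.
  destruct (Z.lt_trichotomy (znorm c) (znorm d)) as [Hlt|[Heq|Hlt]].
  - now apply represents_t_lt.
  - assert (Hc : c <> zzero).
    { intros ->; apply Hnz; split; [reflexivity|]; now apply znorm_eq0. }
    destruct (exists_unit_reduction c d Hc Hcd (eq_sym Heq)) as (l & Hl & Hred).
    set (e := letter_zquat l) in *.
    destruct (represents_exists (zadd d (zmul c e)) c) as [x Hx].
    { rewrite zinner_sym; apply zinner_translate; [apply z0_letter_zquat|assumption]. }
    assert (Hwx : same_coset w (x ++ t ++ [linv l])).
    { apply Huniq; [assumption|].
      apply (rep_step c d e x); [apply z0_letter_zquat|assumption..|].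
      subst e; rewrite <- letter_zquat_linv, tw_letter; [reflexivity|assumption]. }
    (* As e^2 = -1, multiplying (d + c e, c) by -e gives (c - d e, -c e), and translating by e turns
       the second entry into d. *)
    assert (Hx' : represents (zadd c (zmul d (zopp e))) d (x ++ c3 (fst l) ++ [l])).
    { pose proof (represents_tw _ _ e _ (z0_letter_zquat l)
        (represents_opp _ _ _ (represents_klein l _ _ _ Hl Hx))) as H.
      subst e; rewrite (tw_letter l Hl), <- app_assoc in H.
      clear - Hl H; revert H.
      replace (zadd c (zmul d (zopp (letter_zquat l)))) with
        (zopp (zmul (zadd d (zmul c (letter_zquat l))) (letter_zquat l))) by zql l.
      match goal with |- represents _ ?a _ -> _ => replace a with d by zql l end.
      exact (fun H => H). }
    assert (Hwt : represents d c ((x ++ c3 (fst l) ++ [l]) ++ t ++ [l])).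
    { apply (rep_step d c (zopp e) (x ++ c3 (fst l) ++ [l])); trivial.
      - subst e; now rewrite <- letter_zquat_linv, z0_letter_zquat.
      - replace (znorm (zadd c (zmul d (zopp e)))) with (znorm (zadd d (zmul c e)));
          [lia|].
        subst e; rewrite <- (znorm_unit l (zadd d _) Hl), <- znorm_opp.
        f_equal; clear - Hl; zql l.
      - subst e; rewrite <- !letter_zquat_linv, tw_letter, linvK; now destruct l. }
    apply (represents_same_coset _ _ _ _ Hwt).
    rewrite Hwx, <- !app_assoc.
    pose proof (t_letter_t (linv l)) as H; rewrite linvK in H.
    rewrite (H Hl); change (fst (linv l)) with (fst l).
    rewrite (app_assoc [l]), <- (c3_letter l Hl), <- !app_assoc; reflexivity.
  - destruct (represents_exists d c) as [u Hu]; [now rewrite zinner_sym|].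
    apply (represents_same_coset _ _ _ _ Hu).
    rewrite (Huniq _ _ Hw (represents_t_lt _ _ _ Hlt Hu)), <- app_assoc, t_t, app_nil_r.
    reflexivity.
Qed.

Lemma cuspidal_same_coset (u v : word) : cuspidal u -> cuspidal v -> same_coset u v.
Proof.
  assert (H : forall p, cuspidal p -> same_coset p []).
  { intros p Hp; exists p; split; [assumption|]; now rewrite app_nil_r. }
  intros Hu Hv; now rewrite (H u Hu), (H v Hv).
Qed.

Lemma represents_zzero (d : zquat) (w : word) : represents zzero d w -> cuspidal w.
Proof.
  intros H; inversion H as [|? ? m u ? Hm Hlt]; [assumption|].
  pose proof (znorm_ge0 (zadd d (zmul zzero m))).
  change (znorm zzero) with 0%Z in Hlt; lia.
Qed.

(** * Independence of the choice of translation *)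

Definition reduces (c d m : zquat) : Prop :=
  z0 m = 0%Z /\ (znorm (zadd d (zmul c m)) < znorm c)%Z.

(** The two words compared are those that [rep_step] attaches to (c, d) when it starts with m and
    with n. *)
Definition compatible (c d m n : zquat) : Prop :=
  forall u v, represents (zadd d (zmul c m)) c u -> represents (zadd d (zmul c n)) c v ->
  same_coset (u ++ t ++ tw (zopp m)) (v ++ t ++ tw (zopp n)).

Lemma compatible_sym (c d m n : zquat) : compatible c d m n -> compatible c d n m.
Proof. intros H u v Hu Hv; symmetry; now apply H. Qed.

Section Uniqueness.

Variables c d : zquat.
Hypothesis c_d_orthogonal : zinner c d = 0%Z.
(** The induction hypothesis of the descent in [represents_unique]. *)
Hypothesis unique_below : forall a b,
  (znorm a < znorm c)%Z -> zinner a b = 0%Z -> unique_at a b.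

Lemma reduces_orthogonal (m : zquat) : reduces c d m -> zinner (zadd d (zmul c m)) c = 0%Z.
Proof. intros [Hm _]; rewrite zinner_sym; now apply zinner_translate. Qed.

Lemma compatible_refl (m : zquat) : reduces c d m -> compatible c d m m.
Proof.
  intros Hm u v Hu Hv.
  assert (H : same_coset u v).
  { apply (unique_below (zadd d (zmul c m)) c); trivial;
      [apply Hm|now apply reduces_orthogonal]. }
  now rewrite H.
Qed.

(** [compatible] quantifies over representing words, so chaining needs an actual word at the middle
    row; [represents_exists] provides it. *)
Lemma compatible_trans (m n p : zquat) :
  reduces c d n -> compatible c d m n -> compatible c d n p -> compatible c d m p.
Proof.
  intros Hn Hmn Hnp u w Hu Hw.
  destruct (represents_exists (zadd d (zmul c n)) c) as [v Hv].
  { now apply reduces_orthogonal. }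
  rewrite (Hmn u v Hu Hv); now apply Hnp.
Qed.

(* The cusps [m], [m + e] and infinity form a triangle, whose relation is
   [cube_letter]. *)
Lemma compatible_letter (l : letter) (m : zquat) :
  fst l <> gT -> reduces c d m -> reduces c d (zadd m (letter_zquat l)) ->
  compatible c d m (zadd m (letter_zquat l)).
Proof.
  intros Hl Hm Hm' u v Hu Hv.
  pose proof (reduces_orthogonal _ Hm) as Hperp.
  pose proof (reduces_orthogonal _ Hm') as Hperp'.
  destruct Hm as [Hm0 Hm], Hm' as [Hm0' Hm'].
  set (e := letter_zquat l) in *.
  set (A := zadd d (zmul c m)) in *.
  assert (EA : zadd d (zmul c (zadd m e)) = zadd A (zmul c e)) by (subst A; clearbody e; clear; zq).
  rewrite EA in Hm', Hperp', Hv; clear EA.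
  (* The circuit from (A, c): translation by -e gives (A, B), the swap (B, A), multiplication by e
     the row (A + c e, A e), and translation by -e ends at (A + c e, c). The swap is justified by
     uniqueness at A, which is shorter than c. *)
  set (B := zadd c (zmul A (zopp e))).
  assert (Ee : zopp e = letter_zquat (linv l)) by now rewrite letter_zquat_linv.
  assert (He0 : z0 (zopp e) = 0%Z) by (rewrite Ee; apply z0_letter_zquat).
  assert (HB : represents A B (u ++ [linv l])).
  { rewrite <- (tw_letter (linv l)), <- Ee by assumption; now apply represents_tw. }
  assert (HAB : zinner A B = 0%Z) by now apply zinner_translate.
  assert (HBA : represents B A ((u ++ [linv l]) ++ t)).
  { apply represents_t; trivial.
    - intros [EA EB].
      assert (Ec : c = zadd B (zmul A e)) by (subst B; clearbody A e; clear; zq).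
      rewrite EA, EB in Ec.
      assert (E0 : znorm c = 0%Z) by (rewrite Ec; reflexivity).
      pose proof (znorm_ge0 A); lia.
    - now apply unique_below. }
  assert (Hv' : represents (zadd A (zmul c e)) c
    ((((u ++ [linv l]) ++ t) ++ c3 (fst l)) ++ [linv l])).
  { pose proof (represents_tw _ _ (zopp e) _ He0 (represents_klein l _ _ _ Hl HBA)) as H.
    rewrite Ee, tw_letter, <- Ee in H by assumption.
    replace (zadd A (zmul c e)) with (zmul B (letter_zquat l))
      by (subst B e; clearbody A; clear - Hl; zql l).
    match type of H with represents _ ?x _ =>
      replace c with x by (subst B e; clearbody A; clear - Hl; zql l) end.
    exact H. }
  assert (E : same_coset v ((((u ++ [linv l]) ++ t) ++ c3 (fst l)) ++ [linv l])).
  { now apply (unique_below (zadd A (zmul c e)) c). }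
  rewrite E.
  replace (zopp (zadd m e)) with (zadd (zopp e) (zopp m)) by (clearbody e; clear; zq).
  rewrite tw_add, Ee, tw_letter by assumption.
  rewrite <- (t_letter_c3_letter_t (linv l)) at 1 by assumption.
  rewrite <- !app_assoc; reflexivity.
Qed.

Lemma reduces_compatible_letter (l : letter) (m n : zquat) :
  fst l <> gT -> n = zadd m (letter_zquat l) \/ m = zadd n (letter_zquat l) ->
  reduces c d m -> reduces c d n -> compatible c d m n.
Proof.
  intros Hl [->| ->] Hm Hn; [|apply compatible_sym]; now apply compatible_letter.
Qed.

Let n := znorm c.
Let s := zmul (zconj c) d.

(** After scaling by |c|^2, the reducing translations are the lattice points for which s + n m lies
    in the open ball of radius n. Positivity of n is implied by the strict inequality of norms. *)
Lemma reduces_iff (x y z : Z) :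
  reduces c d (mkZ 0 x y z) <->
  (0 < n /\ (z1 s + n * x) * (z1 s + n * x) + (z2 s + n * y) * (z2 s + n * y) +
            (z3 s + n * z) * (z3 s + n * z) < n * n)%Z.
Proof.
  pose proof (znorm_translate c d (mkZ 0 x y z) eq_refl c_d_orthogonal) as E.
  fold s n in E; cbn [z1 z2 z3] in E; cbv zeta in E; rewrite <- E.
  unfold reduces; fold n; cbn [z0].
  pose proof (znorm_ge0 (zadd d (zmul c (mkZ 0 x y z)))).
  set (N := znorm _) in *; clearbody N; split.
  - intros [_ H']; split; nia.
  - intros [H' H'']; split; [reflexivity|nia].
Qed.

(* A lattice point of the open ball stays in it when one coordinate is moved
   towards the centre, and that coordinate moves by at most one. *)
Lemma closer_coordinate (r x x' R : Z) :
  (0 < n)%Z -> (0 <= R)%Z -> ((r + n * x) * (r + n * x) + R < n * n)%Z ->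
  (Z.abs (r + n * x') <= Z.abs (r + n * x))%Z ->
  (x' = x \/ x' = x + 1 \/ x = x' + 1)%Z /\
  ((r + n * x') * (r + n * x') + R < n * n)%Z.
Proof.
  clearbody n; intros Hn HR H Habs.
  assert (Hsq : ((r + n * x') * (r + n * x') <= (r + n * x) * (r + n * x))%Z) by nia.
  assert (Hlt : (Z.abs (r + n * x) < n)%Z) by nia.
  split; [|lia].
  (* Both values lie strictly between -n and n, so they differ by less than 2 n. *)
  assert (H1 : (n * (x' - x) < n * 2)%Z) by lia.
  assert (H2 : (n * (x - x') < n * 2)%Z) by lia.
  apply Z.mul_lt_mono_pos_l in H1, H2; lia.
Qed.

(** By [closer_coordinate] the move is trivial or a single unit step with both ends in the ball,
    where the triangle relation applies. The other two axes are handled in the same way. *)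
Lemma move1 (x x' y z : Z) :
  (Z.abs (z1 s + n * x') <= Z.abs (z1 s + n * x))%Z -> reduces c d (mkZ 0 x y z) ->
  reduces c d (mkZ 0 x' y z) /\ compatible c d (mkZ 0 x y z) (mkZ 0 x' y z).
Proof.
  intros Habs H; pose proof H as H0; apply reduces_iff in H0 as [Hn H0].
  destruct (closer_coordinate (z1 s) x x'
    ((z2 s + n * y) * (z2 s + n * y) + (z3 s + n * z) * (z3 s + n * z)))
    as [Hx H']; [lia|apply Z.add_nonneg_nonneg; apply Z.square_nonneg|lia|lia|].
  assert (Hr : reduces c d (mkZ 0 x' y z)) by (apply reduces_iff; lia).
  split; [assumption|].
  destruct Hx as [->|Hx]; [now apply compatible_refl|].
  apply (reduces_compatible_letter (gI, false)); try easy.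
  destruct Hx as [->| ->]; [left|right]; cbv [zadd letter_zquat fst snd z0 z1 z2 z3]; f_equal; ring.
Qed.

Lemma move2 (x y y' z : Z) :
  (Z.abs (z2 s + n * y') <= Z.abs (z2 s + n * y))%Z -> reduces c d (mkZ 0 x y z) ->
  reduces c d (mkZ 0 x y' z) /\ compatible c d (mkZ 0 x y z) (mkZ 0 x y' z).
Proof.
  intros Habs H; pose proof H as H0; apply reduces_iff in H0 as [Hn H0].
  destruct (closer_coordinate (z2 s) y y'
    ((z1 s + n * x) * (z1 s + n * x) + (z3 s + n * z) * (z3 s + n * z)))
    as [Hy H']; [lia|apply Z.add_nonneg_nonneg; apply Z.square_nonneg|lia|lia|].
  assert (Hr : reduces c d (mkZ 0 x y' z)) by (apply reduces_iff; lia).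
  split; [assumption|].
  destruct Hy as [->|Hy]; [now apply compatible_refl|].
  apply (reduces_compatible_letter (gJ, false)); try easy.
  destruct Hy as [->| ->]; [left|right]; cbv [zadd letter_zquat fst snd z0 z1 z2 z3]; f_equal; ring.
Qed.

Lemma move3 (x y z z' : Z) :
  (Z.abs (z3 s + n * z') <= Z.abs (z3 s + n * z))%Z -> reduces c d (mkZ 0 x y z) ->
  reduces c d (mkZ 0 x y z') /\ compatible c d (mkZ 0 x y z) (mkZ 0 x y z').
Proof.
  intros Habs H; pose proof H as H0; apply reduces_iff in H0 as [Hn H0].
  destruct (closer_coordinate (z3 s) z z'
    ((z1 s + n * x) * (z1 s + n * x) + (z2 s + n * y) * (z2 s + n * y)))
    as [Hz H']; [lia|apply Z.add_nonneg_nonneg; apply Z.square_nonneg|lia|lia|].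
  assert (Hr : reduces c d (mkZ 0 x y z')) by (apply reduces_iff; lia).
  split; [assumption|].
  destruct Hz as [->|Hz]; [now apply compatible_refl|].
  apply (reduces_compatible_letter (gK, false)); try easy.
  destruct Hz as [->| ->]; [left|right]; cbv [zadd letter_zquat fst snd z0 z1 z2 z3]; f_equal; ring.
Qed.

Lemma closer_exists (r x x' : Z) :
  exists k, (Z.abs (r + n * k) <= Z.abs (r + n * x) /\
             Z.abs (r + n * k) <= Z.abs (r + n * x'))%Z.
Proof.
  destruct (Z.le_ge_cases (Z.abs (r + n * x)) (Z.abs (r + n * x')));
    [exists x|exists x']; lia.
Qed.

(** Both points are moved, one coordinate at a time, to a common point that has on each axis
    whichever of the two coordinates is closer to the centre. No move leaves the ball. *)
Lemma reduces_compatible (m m' : zquat) :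
  reduces c d m -> reduces c d m' -> compatible c d m m'.
Proof.
  assert (Hmove : forall x y z x' y' z',
    (Z.abs (z1 s + n * x') <= Z.abs (z1 s + n * x))%Z ->
    (Z.abs (z2 s + n * y') <= Z.abs (z2 s + n * y))%Z ->
    (Z.abs (z3 s + n * z') <= Z.abs (z3 s + n * z))%Z ->
    reduces c d (mkZ 0 x y z) ->
    reduces c d (mkZ 0 x' y' z') /\ compatible c d (mkZ 0 x y z) (mkZ 0 x' y' z')).
  { intros x y z x' y' z' Hx Hy Hz Hr.
    destruct (move1 x x' y z Hx Hr) as [Hr1 C1].
    destruct (move2 x' y y' z Hy Hr1) as [Hr2 C2].
    destruct (move3 x' y' z z' Hz Hr2) as [Hr3 C3].
    split; [assumption|].
    apply (compatible_trans _ _ _ Hr1 C1), (compatible_trans _ _ _ Hr2 C2 C3). }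
  intros Hm Hm'.
  destruct m as [m0 x y z], m' as [m0' x' y' z'].
  assert (m0 = 0%Z) as -> by apply Hm; assert (m0' = 0%Z) as -> by apply Hm'.
  destruct (closer_exists (z1 s) x x') as (kx & Hx & Hx').
  destruct (closer_exists (z2 s) y y') as (ky & Hy & Hy').
  destruct (closer_exists (z3 s) z z') as (kz & Hz & Hz').
  destruct (Hmove x y z kx ky kz Hx Hy Hz Hm) as [Hk C].
  destruct (Hmove x' y' z' kx ky kz Hx' Hy' Hz' Hm') as [_ C'].
  apply (compatible_trans _ _ _ Hk C), compatible_sym, C'.
Qed.

Lemma represents_unique_step : unique_at c d.
Proof.
  intros u v Hu Hv.
  destruct (Z.eq_dec (znorm c) 0) as [H0|H0].
  - apply znorm_eq0 in H0; rewrite H0 in Hu, Hv.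
    apply cuspidal_same_coset; eapply represents_zzero; eassumption.
  - inversion Hu as [|? ? m x ? Hm Hlt Hx Ew]; [subst; now contradiction H0|].
    inversion Hv as [|? ? m' x' ? Hm' Hlt' Hx' Ew']; [subst; now contradiction H0|].
    rewrite Ew, Ew'; now apply (reduces_compatible m m').
Qed.

End Uniqueness.

Lemma represents_unique (c d : zquat) : zinner c d = 0%Z -> unique_at c d.
Proof.
  remember (znorm c) as n eqn:Hn; revert c d Hn.
  induction n as [n IH] using (well_founded_induction (Z.lt_wf 0)); intros c d -> Hcd.
  apply represents_unique_step; [assumption|].
  intros a b Hlt Hab; apply (IH (znorm a)); trivial.
  split; [apply znorm_ge0|assumption].
Qed.

(** * The bottom row of a word *)

(* Rows are acted on from the right by the matrices [[0, 1], [1, 0]] of [T]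
   and [[1, e], [0, 1]] of [tau e]. *)
Definition row_step (r : zquat * zquat) (l : letter) : zquat * zquat :=
  match fst l with
  | gT => (snd r, fst r)
  | _ => (fst r, zadd (snd r) (zmul (fst r) (letter_zquat l)))
  end.

Definition row_act (r : zquat * zquat) (w : word) : zquat * zquat := fold_left row_step w r.

(** Induction on the last letter: a translation is [represents_tw], T is [represents_t].
    Orthogonality and non-vanishing of the row are carried along because the latter requires
    them. *)
Lemma represents_row_act (w : word) :
  let r := row_act (zzero, zone) w in
  represents (fst r) (snd r) w /\ zinner (fst r) (snd r) = 0%Z /\
  ~ (fst r = zzero /\ snd r = zzero).
Proof.
  induction w as [|l w IH] using rev_ind; cbv zeta in *.
  - split; [|now split; [|intros [_ H]]]; apply rep_cusp, cuspidal_nil.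
  - unfold row_act; rewrite fold_left_app; fold (row_act (zzero, zone) w).
    destruct (row_act (zzero, zone) w) as [c d]; cbn [fold_left fst snd] in *.
    destruct IH as (Hrep & Hperp & Hnz).
    assert (Hl : fst l = gT \/ fst l <> gT) by (destruct l as [[] ?]; auto; right; easy).
    destruct Hl as [Hl|Hl].
    + replace (row_step (c, d) l) with (d, c) by (unfold row_step; now rewrite Hl).
      cbn [fst snd]; split; [|split; [now rewrite zinner_sym|tauto]].
      apply (represents_pres_eq _ _ (w ++ t)).
      * apply represents_t; trivial; now apply represents_unique.
      * apply pres_eq_app_l; destruct l as [x []]; simpl in Hl; subst x; [|reflexivity].
        apply (pres_eq_cancel_l t); rewrite t_t; symmetry; apply (letter_linv (gT, false)).
    + replace (row_step (c, d) l) with (c, zadd d (zmul c (letter_zquat l)))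
        by (unfold row_step; now destruct l as [[] ?]).
      cbn [fst snd]; split; [|split].
      * rewrite <- (tw_letter l Hl); apply represents_tw; [apply z0_letter_zquat|assumption].
      * apply zinner_translate; [apply z0_letter_zquat|assumption].
      * intros [-> Hd]; apply Hnz; split; [reflexivity|].
        rewrite <- Hd; zq.
Qed.

(** * The action on the half-space *)

Definition qmul (p q : quat) : quat :=
  mkQ (q0 p * q0 q - q1 p * q1 q - q2 p * q2 q - q3 p * q3 q)
      (q0 p * q1 q + q1 p * q0 q + q2 p * q3 q - q3 p * q2 q)
      (q0 p * q2 q - q1 p * q3 q + q2 p * q0 q + q3 p * q1 q)
      (q0 p * q3 q + q1 p * q2 q - q2 p * q1 q + q3 p * q0 q).

Lemma qmulA (p q r : quat) : qmul p (qmul q r) = qmul (qmul p q) r.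
Proof. destruct p, q, r; unfold qmul; simpl; f_equal; ring. Qed.

Definition quat_of_z (p : zquat) : quat :=
  mkQ (IZR (z0 p)) (IZR (z1 p)) (IZR (z2 p)) (IZR (z3 p)).

Definition row_app (r : zquat * zquat) (q : quat) : quat :=
  qadd (qmul (quat_of_z (fst r)) q) (quat_of_z (snd r)).

Lemma qnorm2_gt0 (q : quat) : H1 q -> 0 < qnorm2 q.
Proof. destruct q as [a b c d]; unfold H1, qnorm2; simpl; intros Ha; nra. Qed.

Lemma letter_map_H1 (l : letter) (q : quat) : H1 q -> H1 (letter_map l q).
Proof.
  intros Hq; pose proof (qnorm2_gt0 q Hq); unfold H1 in *.
  destruct l as [[] []]; simpl; try lra; now apply Rdiv_lt_0_compat.
Qed.

Lemma eval_H1 (w : word) (q : quat) : H1 q -> H1 (eval w q).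
Proof. intros Hq; induction w as [|l w IH]; [assumption|]; now apply letter_map_H1. Qed.

Lemma eval_app (u v : word) (q : quat) : eval (u ++ v) q = eval u (eval v q).
Proof. induction u as [|l u IH]; [reflexivity|]; simpl; now f_equal. Qed.

(** For T the factor is q, because d q + c = (c q^{-1} + d) q; for a translation it is 1. It does
    not depend on the row, so both rows of a matrix share it. *)
Lemma row_app_step (l : letter) (q : quat) :
  H1 q -> exists k, forall r, row_app (row_step r l) q = qmul (row_app r (letter_map l q)) k.
Proof.
  intros Hq; apply qnorm2_gt0 in Hq.
  assert (Htau : fst l <> gT -> forall r,
    row_app (row_step r l) q = qmul (row_app r (letter_map l q)) (mkQ 1 0 0 0)).
  { intros Hl [[c0 c1 c2 c3] [d0 d1 d2 d3]]; destruct q as [a b c d].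
    destruct l as [[] []]; try easy;
      cbv [row_app row_step letter_map letter_zquat tau qadd qmul quat_of_z zadd zmul lat
        qi qj qk qmi qmj qmk fst snd q0 q1 q2 q3 z0 z1 z2 z3];
      rewrite ?plus_IZR, ?minus_IZR, ?plus_IZR, ?mult_IZR; f_equal; ring. }
  destruct l as [x b]; destruct x; [|eexists; now apply Htau..].
  exists q; intros [[c0 c1 c2 c3] [d0 d1 d2 d3]]; destruct q as [x y z u].
  unfold qnorm2 in Hq; simpl in Hq.
  cbv [row_app row_step letter_map T_map qinv qnorm2 qadd qmul quat_of_z
    fst snd q0 q1 q2 q3 z0 z1 z2 z3].
  f_equal; field; lra.
Qed.

(* [k] is the automorphy factor: the bottom row of the matrix of [w] applied to [q]. *)
Lemma row_app_act (w : word) (q : quat) :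
  H1 q -> exists k, forall r, row_app (row_act r w) q = qmul (row_app r (eval w q)) k.
Proof.
  intros Hq; induction w as [|l w [k Hk]].
  - exists (mkQ 1 0 0 0); intros r; simpl.
    destruct (row_app r q); unfold qmul; simpl; f_equal; ring.
  - destruct (row_app_step l (eval w q) (eval_H1 w q Hq)) as [k' Hk'].
    exists (qmul k' k); intros r.
    change (row_act r (l :: w)) with (row_act (row_step r l) w).
    now rewrite Hk, Hk', qmulA.
Qed.

Lemma quat_eq (p q : quat) :
  q0 p = q0 q -> q1 p = q1 q -> q2 p = q2 q -> q3 p = q3 q -> p = q.
Proof. destruct p, q; simpl; intros; now subst. Qed.

(** The rows (1, 0) and (0, 1) share one automorphy factor k. The second gives c q + d = k, and the
    first a q + b = w(q) k, a form free of division. *)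
Lemma eval_matrix (w : word) (q : quat) :
  H1 q -> row_app (row_act (zone, zzero) w) q =
          qmul (eval w q) (row_app (row_act (zzero, zone) w) q).
Proof.
  intros Hq; destruct (row_app_act w q Hq) as [k Hk]; rewrite !Hk, qmulA; f_equal.
  destruct (eval w q) as [x0 x1 x2 x3]; cbv [row_app qadd qmul quat_of_z fst snd q0 q1 q2 q3 z0 z1 z2 z3 zone zzero].
  f_equal; ring.
Qed.

Lemma relator_matrix (r : word) :
  In r relators -> exists s, (s = 1 \/ s = -1)%Z /\
  row_act (zone, zzero) r = (mkZ s 0 0 0, zzero) /\
  row_act (zzero, zone) r = (zzero, mkZ s 0 0 0).
Proof.
  intros Hr; unfold relators in Hr.
  repeat (destruct Hr as [<-|Hr];
    [first [exists 1%Z; vm_compute; now auto | exists (-1)%Z; vm_compute; now auto]|]).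
  destruct Hr.
Qed.

Ltac quat_components H :=
  cbv [row_app qadd qmul quat_of_z fst snd q0 q1 q2 q3 z0 z1 z2 z3 zone zzero] in H;
  injection H as ? ? ? ?.

Lemma eval_relator (r : word) (q : quat) : In r relators -> H1 q -> eval r q = q.
Proof.
  intros Hr Hq; destruct (relator_matrix r Hr) as (s & Hs & Htop & Hbot).
  pose proof (eval_matrix r q Hq) as H; rewrite Htop, Hbot in H.
  destruct (eval r q) as [a b c d], q as [a' b' c' d']; quat_components H.
  destruct Hs as [-> | ->]; apply quat_eq; simpl; lra.
Qed.

Lemma pres_eq_eval (u v : word) : u == v -> forall q, H1 q -> eval u q = eval v q.
Proof.
  induction 1 as [w|u v _ IH|u v w _ IH1 _ IH2|u v l|u v r Hr]; intros q Hq.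
  - reflexivity.
  - symmetry; now apply IH.
  - now rewrite IH1, IH2.
  - change (u ++ l :: linv l :: v) with (u ++ [l; linv l] ++ v).
    rewrite !eval_app; f_equal; generalize (eval_H1 v q Hq); generalize (eval v q).
    intros [a b c d] Hp; pose proof (qnorm2_gt0 _ Hp) as Hn; unfold qnorm2 in Hn; simpl in Hn.
    destruct l as [[] []];
      cbv [eval fold_right linv fst snd negb letter_map T_map qinv qnorm2 tau qadd lat
        qi qj qk qmi qmj qmk q0 q1 q2 q3]; f_equal; try ring; field; nra.
  - rewrite !eval_app; f_equal; apply eval_relator; [assumption|]; now apply eval_H1.
Qed.

Lemma eval_zpow (x : gen) (n : Z) (q : quat) :
  x <> gT -> eval (zpow x n) q =
  tau (lat (match x with gI => n | _ => 0 end) (match x with gJ => n | _ => 0 end)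
           (match x with gK => n | _ => 0 end)) q.
Proof.
  intros Hx.
  assert (H : forall b k, eval (repeat (x, b) k) q =
    let m := (if b then - Z.of_nat k else Z.of_nat k)%Z in
    tau (lat (match x with gI => m | _ => 0 end) (match x with gJ => m | _ => 0 end)
           (match x with gK => m | _ => 0 end)) q).
  { intros b k; induction k as [|k IH].
    - destruct q as [q0' q1' q2' q3'], x, b; try easy; unfold tau, qadd, lat; simpl; f_equal; ring.
    - change (eval (repeat (x, b) (S k)) q) with (letter_map (x, b) (eval (repeat (x, b) k) q)).
      rewrite IH, Nat2Z.inj_succ; unfold Z.succ; cbv zeta.
      destruct q as [q0' q1' q2' q3'], x, b; try easy;
        cbv [tau qadd lat letter_map qi qj qk qmi qmj qmk q0 q1 q2 q3];
        rewrite ?opp_IZR, ?plus_IZR; f_equal; ring. }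
  unfold zpow; rewrite H; cbv zeta.
  destruct (Z.ltb_spec n 0);
    [replace (- Z.of_nat (Z.abs_nat n))%Z with n by lia
    |replace (Z.of_nat (Z.abs_nat n))%Z with n by lia]; reflexivity.
Qed.

Lemma eval_tw (m : zquat) (q : quat) : eval (tw m) q = tau (lat (z1 m) (z2 m) (z3 m)) q.
Proof.
  unfold tw; rewrite !eval_app, !eval_zpow by easy.
  destruct q; unfold tau, qadd, lat; simpl; f_equal; ring.
Qed.

(** Outside the identity the matrix is diag(e, e), so [eval_matrix] reads e q = w(q) e, a linear
    system for the coordinates of w(q). *)
Lemma eval_klein (x : gen) (q : quat) :
  H1 q -> eval (klein x) q =
  mkQ (q0 q)
      (match x with gT | gI => q1 q | _ => - q1 q end)
      (match x with gT | gJ => q2 q | _ => - q2 q end)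
      (match x with gT | gK => q3 q | _ => - q3 q end).
Proof.
  intros Hq; pose proof (eval_matrix (klein x) q Hq) as H.
  destruct x; [now destruct q|..]; revert H; generalize (eval (klein gI) q) (eval (klein gJ) q)
    (eval (klein gK) q); intros [x0 x1 x2 x3] [y0 y1 y2 y3] [u0 u1 u2 u3] H; destruct q as [a b c d];
  cbv -[Rplus Rmult Rminus Ropp IZR] in H; injection H as ? ? ? ?;
  apply quat_eq; simpl; lra.
Qed.

(** * Words acting trivially *)

Lemma cuspidal_trivial (w : word) :
  cuspidal w -> (forall q, H1 q -> eval w q = q) -> w == [].
Proof.
  intros (m & x & Hw) H.
  assert (H' : forall q, H1 q -> eval (tw m ++ klein x) q = q).
  { intros q Hq; rewrite <- (pres_eq_eval _ _ Hw q Hq); now apply H. }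
  (* The point 1 is fixed by the Klein group and reveals the translation; at 1 + i + j + k every
     nontrivial Klein element changes some sign. *)
  assert (A : H1 (mkQ 1 0 0 0)) by (unfold H1; simpl; lra).
  assert (B : H1 (mkQ 1 1 1 1)) by (unfold H1; simpl; lra).
  pose proof (H' _ A) as HA; pose proof (H' _ B) as HB.
  rewrite eval_app, eval_klein, eval_tw in HA, HB by assumption.
  destruct m as [m0 a b c]; unfold tau, qadd, lat in HA, HB; simpl in HA, HB.
  injection HA as _ HA1 HA2 HA3; injection HB as _ HB1 HB2 HB3.
  assert (a = 0%Z) as -> by (apply eq_IZR; destruct x; lra).
  assert (b = 0%Z) as -> by (apply eq_IZR; destruct x; lra).
  assert (c = 0%Z) as -> by (apply eq_IZR; destruct x; lra).
  rewrite Hw; destruct x; [reflexivity|exfalso; lra..].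
Qed.

(** At a real point q = x the matrix identity becomes a x + b = c x^2 + d x. Three values of x force
    the quadratic coefficient c to vanish. *)
Lemma trivial_action_bottom_row (w : word) :
  (forall q, H1 q -> eval w q = q) -> fst (row_act (zzero, zone) w) = zzero.
Proof.
  intros H.
  assert (E : forall x, 0 < x -> row_app (row_act (zone, zzero) w) (mkQ x 0 0 0) =
    qmul (mkQ x 0 0 0) (row_app (row_act (zzero, zone) w) (mkQ x 0 0 0))).
  { intros x Hx; rewrite eval_matrix, H; [reflexivity|exact Hx..]. }
  destruct (row_act (zone, zzero) w) as [[a0 a1 a2 a3] [b0 b1 b2 b3]],
    (row_act (zzero, zone) w) as [[c0 c1 c2 c3] [d0 d1 d2 d3]].
  pose proof (E 1 ltac:(lra)) as E1; pose proof (E 2 ltac:(lra)) as E2;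
    pose proof (E 3 ltac:(lra)) as E3; clear E.
  quat_components E1; quat_components E2; quat_components E3.
  simpl; unfold zzero; f_equal; apply eq_IZR; lra.
Qed.

Theorem theorem8p1 :
  (forall f, in_PSL2L f -> exists w : word, forall q, H1 q -> eval w q = f q) /\
  (forall w : word, (forall q, H1 q -> eval w q = q) <-> pres_eq w []).
Proof.
  split.
  - induction 1 as [|f _ [w Hw]|b c d f _ [w Hw]].
    + now exists [].
    + exists (t ++ w); intros q Hq; rewrite eval_app, Hw by assumption; reflexivity.
    + exists (tw (mkZ 0 b c d) ++ w); intros q Hq.
      now rewrite eval_app, Hw, eval_tw by assumption.
  - intros w; split; [|intros H q Hq; now rewrite (pres_eq_eval _ _ H q Hq)].
    intros H; apply cuspidal_trivial; [|assumption].
    destruct (represents_row_act w) as [Hrep _].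
    rewrite (trivial_action_bottom_row w H) in Hrep.
    now apply represents_zzero in Hrep.
Qed.
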